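(* Let $M$ be an $n\times n$ matrix with real entries. Suppose that $M$ is of type $1$ (i.e. every column of $M$ sums to $1$) and that there exists a positive integer $p$ such that $\operatorname{var}(M^p) < 1$. Then the following statements are true. (a) There exists a unique $E \in \mathbb{R}^n$ such that $ME = E$ and $\operatorname{sum} E = 1$. (b) Let $P$ be the $n\times n$ matrix each of whose columns is equal to $E$. Then $P$ is a projection (i.e. $P^2=P$) and $PX = (\operatorname{sum} X)\,E$ for each $X \in \mathbb{R}^n$. (c) The powers $M^k$ tend to $P$ as $k$ tends to $+\infty$.
   Context: All matrices have real entries, which may be negative. Elements of $\mathbb{R}^n$ are identified with $n\times 1$ column matrices. For $X\in\mathbb{R}^n$ with entries $x_1,\dots,x_n$, set $\operatorname{sum} X := \sum_{j=1}^n x_j$ and $\|X\| := \sum_{j=1}^n |x_j|$ (the $\ell_1$-norm). For an $m\times n$ matrix $A$ with columns $A_1,\dots,A_n$, the variation of $A$ is $\operatorname{var} A := \frac{1}{2}\max_{1\le j,k\le n}\|A_j - A_k\|$. A matrix $A$ is of type $a$ if all of its column sums are equal to $a$. *)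

(* Defs.v *)
From HB Require Import structures.
From mathcomp Require Import all_boot all_order all_algebra.
From mathcomp Require Import all_classical all_reals all_analysis.

Set Implicit Arguments.
Unset Strict Implicit.
Unset Printing Implicit Defensive.

Import Order.TTheory GRing.Theory Num.Theory.
Import numFieldNormedType.Exports.

Local Open Scope ring_scope.

Definition vsum (R : realType) (n : nat) (X : 'cV[R]_n) : R :=
  \sum_(j < n) X j 0.

(* The library's norm on matrices is the sup norm, hence this definition. *)
Definition l1norm (R : realType) (n : nat) (X : 'cV[R]_n) : R :=
  \sum_(j < n) `|X j 0|.

(* The terms are nonnegative, so the default value 0 does not affect
   the maximum when n > 0. *)
Definition mxvar (R : realType) (m n : nat) (A : 'M[R]_(m, n)) : R :=
  2^-1 * \big[Num.max/0]_(j < n) \big[Num.max/0]_(k < n)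
           l1norm (col j A - col k A).

Definition of_type (R : realType) (m n : nat) (a : R) (A : 'M[R]_(m, n)) :
    Prop :=
  forall j : 'I_n, vsum (col j A) = a.

(* Main.v *)
Require Import Defs.
From HB Require Import structures.
From mathcomp Require Import all_boot all_order all_algebra.
From mathcomp Require Import all_classical all_reals all_analysis.
From mathcomp Require Import ring lra.

(* On vectors of sum zero, [A] contracts the l1-norm by the factor [var A];
   so some power of [M] is a strict contraction there.  As [M] has column sums
   1, it has a nonzero fixed vector, whose sum cannot vanish by contraction;
   rescaling gives [E].  Finally [M P = P], so [M^k - P = M^k (1 - P)], and the
   columns of [1 - P] have sum zero. *)

Set Implicit Arguments.
Unset Strict Implicit.
Unset Printing Implicit Defensive.

Import Order.TTheory GRing.Theory Num.Theory.
Import numFieldNormedType.Exports.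

Local Open Scope classical_set_scope.
Local Open Scope ring_scope.

Section L1norm.
Variables (R : realType) (n : nat).
Implicit Types X Y : 'cV[R]_n.

(** Writing the sum as a product with the row of ones turns linearity and the column-sum hypothesis
    into matrix identities. *)
Lemma vsumE X : vsum X = ((const_mx 1 : 'rV_n) *m X) 0 0.
Proof. by rewrite mxE; apply: eq_bigr => j _; rewrite mxE mul1r. Qed.

Lemma vsumB X Y : vsum (X - Y) = vsum X - vsum Y.
Proof. by rewrite !vsumE mulmxBr !mxE. Qed.

Lemma l1norm_ge0 X : 0 <= l1norm X.
Proof. by apply: sumr_ge0 => j _; exact: normr_ge0. Qed.

Lemma ler_l1norm X i : `|X i 0| <= l1norm X.
Proof. by rewrite /l1norm (bigD1 i) //= lerDl; apply: sumr_ge0. Qed.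

Lemma l1norm_eq0 X : l1norm X = 0 -> X = 0.
Proof.
move=> X0; apply/matrixP => i j; rewrite ord1 mxE.
by apply/eqP; rewrite -normr_le0 -X0 ler_l1norm.
Qed.

Lemma l1normZ (a : R) X : l1norm (a *: X) = `|a| * l1norm X.
Proof.
by rewrite /l1norm mulr_sumr; apply: eq_bigr => j _; rewrite mxE normrM.
Qed.

Lemma l1norm_sum (I : finType) (F : I -> 'cV[R]_n) :
  l1norm (\sum_i F i) <= \sum_i l1norm (F i).
Proof.
rewrite /l1norm exchange_big /=; apply: ler_sum => j _.
by rewrite summxE; exact: ler_norm_sum.
Qed.

End L1norm.

Section Contraction.
Variable R : realType.

Lemma mxvar_ge0 m n (A : 'M[R]_(m, n)) : 0 <= mxvar A.
Proof. by rewrite mulr_ge0 ?invr_ge0 ?ler0n// bigmax_ge_id. Qed.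

Lemma l1norm_colB_le m n (A : 'M[R]_(m, n)) j k :
  l1norm (col j A - col k A) <= 2 * mxvar A.
Proof.
rewrite /mxvar mulrA divff ?pnatr_eq0// mul1r.
apply: le_trans (le_bigmax _ _ j).
exact: (le_bigmax _ (fun k => l1norm (col j A - col k A))).
Qed.

(* With [p] and [q] the positive and negative parts of [X], both of sum
   [s = |X|/2], one has [s A X = \sum_(j, k) p_j q_k (A_j - A_k)]. *)
Lemma l1norm_mulmx_le m n (A : 'M[R]_(m, n)) (X : 'cV[R]_n) :
  vsum X = 0 -> l1norm (A *m X) <= mxvar A * l1norm X.
Proof.
move=> X0.
pose p j : R := (`|X j 0| + X j 0) / 2; pose q j : R := (`|X j 0| - X j 0) / 2.
pose s := l1norm X / 2.
have p0 j : 0 <= p j.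
  by rewrite /p; have := ler_norm (- X j 0); rewrite normrN; lra.
have q0 j : 0 <= q j.
  by rewrite /q; have := ler_norm (X j 0); lra.
have sp : \sum_j p j = s.
  by rewrite -mulr_suml big_split /= -/(vsum X) X0 addr0.
have sq : \sum_j q j = s.
  by rewrite -mulr_suml sumrB /= -/(vsum X) X0 subr0.
have [/l1norm_eq0 ->|Xn0] := eqVneq (l1norm X) 0.
  by rewrite mulmx0 /l1norm !big1 ?mulr0// => i _; rewrite mxE normr0.
have s0 : 0 < s by rewrite divr_gt0// lt_def Xn0 l1norm_ge0.
have sAX : s *: (A *m X) =
      \sum_j \sum_k (p j * q k) *: (col j A - col k A).
  apply/matrixP => i z; rewrite ord1 !mxE summxE [LHS]mulrC.
  transitivity (\sum_j (p j * A i j * s - p j * \sum_k q k * A i k)).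
    rewrite sumrB -[X in X - _]mulr_suml -[X in _ - X]mulr_suml sp.
    rewrite [s * _]mulrC -mulrBl -sumrB; congr (_ * _).
    by apply: eq_bigr => j _; rewrite /p /q; field.
  apply: eq_bigr => j _; rewrite summxE -sq !mulr_sumr -sumrB.
  by apply: eq_bigr => k _; rewrite !mxE; ring.
rewrite -(ler_pM2l s0) -{1}(gtr0_norm s0) -l1normZ sAX.
apply: le_trans (l1norm_sum _) _.
(* The weights [p j * q k] total [s ^+ 2], each difference of columns has norm at most
   [2 * mxvar A], and [l1norm X = 2 * s]. *)
have -> : s * (mxvar A * l1norm X) = \sum_j p j * (s * (2 * mxvar A)).
  by rewrite -mulr_suml sp /s; field.
apply: ler_sum => j _; apply: le_trans (l1norm_sum _) _.
rewrite -sq mulr_suml mulr_sumr; apply: ler_sum => k _.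
rewrite l1normZ normrM !ger0_norm// -mulrA.
by rewrite !ler_wpM2l// l1norm_colB_le.
Qed.

End Contraction.

Section Powers.
Variables (R : realType) (n : nat) (M : 'M[R]_n.+1).
Hypothesis M1 : of_type 1 M.

Lemma of_type1E : const_mx 1 *m M = const_mx 1 :> 'rV_n.+1.
Proof.
apply/matrixP => i j; rewrite !mxE -[RHS](M1 j).
by apply: eq_bigr => k _; rewrite !mxE mul1r.
Qed.

Lemma vsum_mulmx (X : 'cV[R]_n.+1) : vsum (M *m X) = vsum X.
Proof. by rewrite !vsumE mulmxA of_type1E. Qed.

Lemma vsum_exp_mulmx k (X : 'cV[R]_n.+1) : vsum (M ^+ k *m X) = vsum X.
Proof.
elim: k => [|k IH]; first by rewrite expr0 mul1mx.
by rewrite exprS -mulmxE -mulmxA vsum_mulmx.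
Qed.

Lemma exp_mulmx_fix k (X : 'cV[R]_n.+1) : M *m X = X -> M ^+ k *m X = X.
Proof.
move=> MX; elim: k => [|k IH]; first by rewrite expr0 mul1mx.
by rewrite exprS -mulmxE -mulmxA IH.
Qed.

(** Peel off one factor [M ^+ p] at a time: [M] preserves [vsum], so the remaining vector still has
    sum zero and the contraction applies again. *)
Lemma l1norm_exp_mulmx_le p q r (X : 'cV[R]_n.+1) : vsum X = 0 ->
  l1norm (M ^+ (q * p + r) *m X) <= mxvar (M ^+ p) ^+ q * l1norm (M ^+ r *m X).
Proof.
move=> X0; elim: q => [|q IH]; first by rewrite expr0 mul1r.
rewrite mulSn -addnA exprD -mulmxE -mulmxA exprS -mulrA.
apply: le_trans (l1norm_mulmx_le _ _) _; first by rewrite vsum_exp_mulmx.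
by rewrite ler_wpM2l ?mxvar_ge0.
Qed.

Variable p : nat.
Hypotheses (p_gt0 : (0 < p)%N) (varMp : mxvar (M ^+ p) < 1).

(** Since [X] is also fixed by [M ^+ p], its norm is at most [mxvar (M ^+ p) < 1] times itself. This
    serves both existence and uniqueness of [E]. *)
Lemma fix_vsum0_eq0 (X : 'cV[R]_n.+1) : M *m X = X -> vsum X = 0 -> X = 0.
Proof.
move=> MX X0; apply: l1norm_eq0.
have := l1norm_mulmx_le (M ^+ p) X0; rewrite exp_mulmx_fix//.
rewrite -subr_le0 -{1}[l1norm X]mul1r -mulrBl pmulr_rle0 ?subr_gt0// => Xle0.
by apply/eqP; rewrite eq_le Xle0 l1norm_ge0.
Qed.

Lemma exists_fix_vsum1 : exists2 E : 'cV[R]_n.+1, M *m E = E & vsum E = 1.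
Proof.
(* The row of ones is a left null vector of [M - 1], which is therefore singular. As [det0P] speaks
   of left null vectors, a right one is extracted through the transpose. *)
have : \det (M - 1%:M)^T == 0.
  rewrite det_tr; apply/det0P; exists (const_mx 1).
    by apply/eqP => /matrixP/(_ 0 0)/eqP; rewrite !mxE oner_eq0.
  by rewrite mulmxBr mulmx1 of_type1E subrr.
move=> /det0P[v v0 vM].
have Mv : M *m v^T = v^T.
  apply/eqP; rewrite -subr_eq0 -{2}[v^T]mul1mx -mulmxBl.
  by rewrite -[M - _]trmxK -trmx_mul vM trmx0.
have s0 : vsum v^T != 0.
  apply: contra v0 => /eqP /(fix_vsum0_eq0 Mv) vT0.
  by rewrite -[v]trmxK vT0 trmx0.
exists ((vsum v^T)^-1 *: v^T); first by rewrite -scalemxAr Mv.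
by rewrite vsumE -scalemxAr mxE -vsumE mulVf.
Qed.

Lemma cvg_exp_mulmx_vsum0 (X : 'cV[R]_n.+1) : vsum X = 0 ->
  (fun k => l1norm (M ^+ k *m X)) @ \oo --> (0 : R).
Proof.
move=> X0; set c := mxvar (M ^+ p).
(* Write [k] as [(k %/ p) * p + k %% p]: [K] bounds the norm for every remainder at once, and the
   quotient tends to infinity. *)
pose K := \sum_(r < p) l1norm (M ^+ r *m X).
have divp_oo : (fun k => k %/ p)%N @ \oo --> \oo.
  move=> A [N _ NA]; exists (N * p)%N => // k /= Nk.
  by apply: NA; rewrite /= leq_divRL.
apply: (@squeeze_cvgr _ _ _ _ (fun=> 0) (fun k => c ^+ (k %/ p) * K)).
- apply: nearW => k; rewrite l1norm_ge0/= {1}(divn_eq k p).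
  apply: le_trans (l1norm_exp_mulmx_le _ _ _ X0) _.
  rewrite ler_wpM2l ?exprn_ge0 ?mxvar_ge0// /K.
  have kp : (k %% p < p)%N by rewrite ltn_mod.
  rewrite (bigD1 (Ordinal kp))//= lerDl.
  by apply: sumr_ge0 => r _; exact: l1norm_ge0.
- exact: cvg_cst.
- rewrite -[X in _ --> X](mul0r K); apply: cvgMr_tmp.
  have c1 : `|c| < 1 by rewrite ger0_norm ?mxvar_ge0.
  exact: (cvg_comp _ _ divp_oo (cvg_expr c1)).
Qed.

End Powers.

Theorem theorem4p2 (R : realType) (n : nat) (M : 'M[R]_n.+1)
    (hM : of_type 1 M)
    (hvar : exists p : nat, (0 < p)%N /\ mxvar (M ^+ p) < 1) :
  exists E : 'cV[R]_n.+1,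
    unique (fun F : 'cV[R]_n.+1 => M *m F = F /\ vsum F = 1) E /\
    let P : 'M[R]_n.+1 := \matrix_(i, j) E i 0 in
    (P *m P = P /\ forall X : 'cV[R]_n.+1, P *m X = vsum X *: E) /\
    (fun k : nat => M ^+ k) @ \oo --> P.
Proof.
have [p [p_gt0 varMp]] := hvar.
have [E ME E1] := exists_fix_vsum1 hM varMp.
exists E; split.
  split=> // F [MF F1]; apply/eqP; rewrite -subr_eq0; apply/eqP.
  apply: (fix_vsum0_eq0 varMp); first by rewrite mulmxBr ME MF.
  by rewrite vsumB E1 F1 subrr.
move=> P; have PE : P = E *m const_mx 1.
  by apply/matrixP => i j; rewrite !mxE big_ord1 mxE mulr1.
have PX (X : 'cV_n.+1) : P *m X = vsum X *: E.
  by rewrite PE -mulmxA [const_mx 1 *m X]mx11_scalar -vsumE mul_mx_scalar.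
split; first split=> //.
  by rewrite {2}PE mulmxA PX E1 scale1r -PE.
(* Column [j] is the [j]-th basis vector minus [E], and both have sum 1. *)
have Y0 j : vsum (col j (1%:M - P)) = 0.
  rewrite linearB vsumB; apply/eqP; rewrite subr_eq0; apply/eqP.
  rewrite /vsum (bigD1 j)//= big1 ?addr0 => [|i /negPf ij]; rewrite !mxE ?ij//.
  by rewrite eqxx -[LHS]E1; apply: eq_bigr => i _; rewrite !mxE.
have MkP k : M ^+ k - P = M ^+ k *m (1%:M - P).
  by rewrite mulmxBr mulmx1 PE mulmxA exp_mulmx_fix.
apply/cvgrPdist_le => e e0.
have cvgY j := cvg_exp_mulmx_vsum0 hM p_gt0 varMp (Y0 j).
have : \forall k \near \oo, forall j, l1norm (M ^+ k *m col j (1%:M - P)) <= e.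
  (* There are finitely many columns, so one threshold for [k] serves them all. *)
  apply: filter_forall => j.
  move/cvgrPdist_le: (cvgY j) => /(_ e e0); apply: filterS => k.
  by rewrite sub0r normrN ger0_norm ?l1norm_ge0.
apply: filterS => k Hk; rewrite distrC MkP.
(* The norm here is the largest absolute value of an entry, and an entry is bounded by the l1-norm
   of its column. The default value 0 of the maximum is covered by [0 < e]. *)
rewrite /Num.norm/= mx_normrE; apply: bigmax_le; first exact: ltW.
move=> [i j] _ /=; apply: le_trans (Hk j).
by apply: le_trans (ler_l1norm _ i); rewrite colE mulmxA -colE [X in _ <= `|X|]mxE.
Qed.
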